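(* The following conditions are equivalent for a locally convex topological vector space $X$: (1) $X$ is an injective object of the category $\mathcal{LCS}$. (2) $X$ is isomorphic to a product $\prod\{F_t\colon t\in T\}$, where each $F_t$, $t\in T$, is a complemented subspace of a product $\prod\{\ell_\infty(J_{t_n})\colon n\in\omega\}$ for some sets $J_{t_n}$, $n\in\omega$.
   Context: $\mathcal{LCS}$ is the category of locally convex Hausdorff topological vector spaces over $\mathbb C$ and continuous linear maps; locally convex spaces are assumed Hausdorff, and isomorphic means linearly homeomorphic. An object $X$ of $\mathcal{LCS}$ is injective if every continuous linear map $f\colon A\to X$ defined on a linear subspace $A$ (with the induced topology) of an object $B$ of $\mathcal{LCS}$ admits a continuous linear extension $g\colon B\to X$, $g|A=f$. For a set $J$, $\ell_\infty(J)$ is the Banach space of bounded families $\{x_j\colon j\in J\}$ of complex numbers with the supremum norm. A subspace $F$ of a locally convex space $E$ is complemented if there is a continuous linear map $r\colon E\to F$ with $r(x)=x$ for all $x\in F$. Products carry the product topology. *)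

(* Defs.v *)
From HB Require Import structures.
From mathcomp Require Import all_boot all_order all_algebra.
From mathcomp Require Import all_classical all_reals.
From mathcomp Require Import topology normedtype convex.
From mathcomp Require Import complex.

Set Implicit Arguments.
Unset Strict Implicit.
Unset Printing Implicit Defensive.

Import Order.TTheory GRing.Theory Num.Theory.
Import numFieldNormedType.Exports.

Local Open Scope classical_set_scope.
Local Open Scope ring_scope.

Section continuity_into.
Variables (Z : topologicalType).

Lemma continuous_into_initial (S : choiceType) (Y : topologicalType)
    (f : S -> Y) (g : Z -> initial_topology f) :
  continuous (f \o g : Z -> Y) -> continuous g.
Proof.
move=> /continuousP cfg; apply/continuousP => _ [B oB <-].
by rewrite -comp_preimage; exact: cfg.
Qed.

Variables (I : Type) (T : I -> topologicalType).

Lemma prod_topology_proj (i : I) : continuous (fun x : prod_topology T => x i).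
Proof.
move=> x; have : x --> x by exact: cvg_id.
move=> /cvg_sup /(_ i) xx.
apply: cvg_trans (@initial_continuous _ _ (@^~ i) x).
exact: (cvg_app (@^~ i) xx).
Qed.

Lemma continuous_into_prod (g : Z -> prod_topology T) :
  (forall i, continuous (fun z => g z i)) -> continuous g.
Proof.
move=> cg z; apply/cvg_sup => i.
exact: (@continuous_into_initial _ _ (@^~ i) g (cg i)).
Qed.

End continuity_into.

Section locally_convex.
Variables (K : numFieldType).

Lemma convex_set_preimage (E F : lmodType K) (f : {linear E -> F}) (A : set F) :
  convex_set A -> convex_set (f @^-1` A).
Proof.
move=> cA x y l /set_mem Ax /set_mem Ay; apply/mem_set => /=.
have -> : f (conv l x y) = conv l (f x : convex_lmodType F) (f y).
  by rewrite /conv /= linearD !linearZ.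
by apply/set_mem/cA; exact/mem_set.
Qed.

End locally_convex.

Section open_convex.
Variables (K : numFieldType) (E : preTopologicalLmodType K).

Definition open_convex_sets : set_system E :=
  [set U | open U /\ convex_set (U : set (convex_lmodType E))].

Lemma open_convex_basis :
  (forall x U, nbhs x U -> exists2 V, open_convex_sets V & V x /\ V `<=` U) ->
  exists2 B : set_system E, (forall b, b \in B -> convex_set b) & basis B.
Proof.
move=> h; exists open_convex_sets; first by move=> b /set_mem[].
split=> [b []//|x U /h[V oV [Vx VU]]].
by exists V.
Qed.

End open_convex.

Lemma tvs_open_convex (K : numFieldType) (E : tvsType K) (x : E) U :
  nbhs x U -> exists2 V, open_convex_sets V & V x /\ V `<=` U.
Proof.
move=> xU; have [B Bc [Bo /(_ x U xU)[V [BV Vx] VU]]] := @locally_convex K E.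
by exists V => //; split; [exact: Bo|apply/Bc/mem_set].
Qed.

(* A linear subspace [A] of [E], as a type of its own, with the induced
   topology. *)
Section subtvs.
Variables (K : numFieldType) (E : tvsType K) (A : submodClosed E).

(* [submodClosed] is a semimodule notion and does not register closure under
   opposites; this alias of [A] does. *)
Definition subtvs_pred : {pred E} := A.

Lemma subtvs_pred_submod_closed : submod_closed subtvs_pred.
Proof. exact: submodClosedP. Qed.

HB.instance Definition _ :=
  GRing.isSubmodClosed.Build K E subtvs_pred subtvs_pred_submod_closed.

Record subtvs := SubTvs { subtvs_val : E ; subtvs_valP : subtvs_val \in subtvs_pred }.

HB.instance Definition _ := [isSub for subtvs_val].
HB.instance Definition _ := [Choice of subtvs by <:].
HB.instance Definition _ := [SubChoice_isSubZmodule of subtvs by <:].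
HB.instance Definition _ := [SubZmodule_isSubLmodule of subtvs by <:].
HB.instance Definition _ := Uniform.copy subtvs (initial_topology subtvs_val).

Lemma subtvs_val_continuous : continuous (\val : subtvs -> E).
Proof. exact: initial_continuous. Qed.

Lemma subtvs_continuous (Z : topologicalType) (g : Z -> subtvs) :
  continuous (\val \o g : Z -> E) -> continuous g.
Proof. exact: continuous_into_initial. Qed.

Let add_continuous : continuous (fun x : subtvs * subtvs => x.1 + x.2).
Proof.
apply: subtvs_continuous.
change (continuous ((fun u : E * E => u.1 + u.2) \o
  (fun x : subtvs * subtvs => (\val x.1 : E, \val x.2 : E)))) => x.
apply: continuous_comp; last exact: add_continuous.
by apply: cvg_pair; (apply: continuous_comp; last exact: subtvs_val_continuous);
  [exact: cvg_fst|exact: cvg_snd].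
Qed.

Let scale_continuous : continuous (fun z : K^o * subtvs => z.1 *: z.2).
Proof.
apply: (@subtvs_continuous (K^o * subtvs)%type).
change (continuous ((fun u : K^o * E => u.1 *: u.2) \o
  (fun x : K^o * subtvs => (x.1, \val x.2 : E)))) => x.
apply: continuous_comp; last exact: scale_continuous.
have c2 : (fun z : K^o * subtvs => \val z.2 : E) @ x --> (\val x.2 : E).
  by apply: continuous_comp; [exact: cvg_snd|exact: subtvs_val_continuous].
exact: (cvg_pair (@cvg_fst _ _ (nbhs x.1) (nbhs x.2) _) c2).
Qed.

Let locally_convex : exists2 B : set_system subtvs,
  (forall b, b \in B -> convex_set b) & basis B.
Proof.
apply: open_convex_basis => x U [_ [[W oW <-] Wx WU]].
have [V [oV cV] [Vx VW]] := tvs_open_convex (open_nbhs_nbhs (conj oW Wx)).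
exists (\val @^-1` V); last by split=> // y /VW; exact: WU.
split; first by exists V.
exact: (@convex_set_preimage _ subtvs E \val).
Qed.

HB.instance Definition _ :=
  PreTopologicalNmodule_isTopologicalNmodule.Build subtvs add_continuous.
HB.instance Definition _ :=
  TopologicalNmodule_isTopologicalLmodule.Build K subtvs scale_continuous.
HB.instance Definition _ := Uniform_isTvs.Build K subtvs locally_convex.

End subtvs.

Lemma subtvs_hausdorff (K : numFieldType) (E : tvsType K) (A : submodClosed E) :
  hausdorff_space E -> hausdorff_space (subtvs A).
Proof.
rewrite !open_hausdorff => hE x y xy.
have /hE[[U V] /= [Ux Vy] [oU oV UV]] : \val x != \val y.
  by rewrite (inj_eq val_inj).
exists (\val @^-1` U, \val @^-1` V) => /=.
  by move: Ux Vy; rewrite !inE.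
split; [by exists U|by exists V|].
by apply/eqP; rewrite /= -preimage_setI (eqP UV) preimage_set0.
Qed.

Section tvs_prod.
Variables (K : numFieldType) (I : Type) (T : I -> tvsType K).

Definition tvs_prod : Type := forall i, T i.

HB.instance Definition _ := Uniform.copy tvs_prod (prod_topology T).

Implicit Types f g : tvs_prod.

Let add f g : tvs_prod := fun i => f i + g i.
Let opp f : tvs_prod := fun i => - f i.
Let zero : tvs_prod := fun i => 0.
Let scale (k : K) f : tvs_prod := fun i => k *: f i.

Let addA : associative add.
Proof. by move=> f g h; apply: functional_extensionality_dep => i; exact: addrA. Qed.

Let addC : commutative add.
Proof. by move=> f g; apply: functional_extensionality_dep => i; exact: addrC. Qed.

Let add0 : left_id zero add.
Proof. by move=> f; apply: functional_extensionality_dep => i; exact: add0r. Qed.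

Let addN : left_inverse zero opp add.
Proof. by move=> f; apply: functional_extensionality_dep => i; exact: addNr. Qed.

HB.instance Definition _ := GRing.isZmodule.Build tvs_prod addA addC add0 addN.

Let scaleA k l f : scale k (scale l f) = scale (k * l) f.
Proof. by apply: functional_extensionality_dep => i; exact: scalerA. Qed.

Let scale1 : left_id 1 scale.
Proof. by move=> f; apply: functional_extensionality_dep => i; exact: scale1r. Qed.

Let scaleDr : right_distributive scale +%R.
Proof. by move=> k f g; apply: functional_extensionality_dep => i; exact: scalerDr. Qed.

Let scaleDl f : {morph scale^~ f : k l / k + l}.
Proof. by move=> k l; apply: functional_extensionality_dep => i; exact: scalerDl. Qed.

HB.instance Definition _ := GRing.Zmodule_isLmodule.Build K tvs_prod
  scaleA scale1 scaleDr scaleDl.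

Lemma tvs_prod_proj_continuous i : continuous (fun f : tvs_prod => f i).
Proof. exact: prod_topology_proj. Qed.

Lemma tvs_prod_continuous (Z : topologicalType) (g : Z -> tvs_prod) :
  (forall i, continuous (fun z => g z i)) -> continuous g.
Proof. exact: continuous_into_prod. Qed.

Lemma tvs_prod_hausdorff :
  (forall i, hausdorff_space (T i)) -> hausdorff_space tvs_prod.
Proof. exact: (@hausdorff_product {classic I} T). Qed.

Let add_continuous : continuous (fun x : tvs_prod * tvs_prod => x.1 + x.2).
Proof.
apply: tvs_prod_continuous => i.
change (continuous ((fun u : T i * T i => u.1 + u.2) \o
  (fun x : tvs_prod * tvs_prod => (x.1 i, x.2 i)))) => x.
apply: continuous_comp; last exact: add_continuous.
have c1 : (fun z : tvs_prod * tvs_prod => z.1 i) @ x --> x.1 i.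
  apply: (@continuous_comp _ _ _ fst (fun y : tvs_prod => y i)); first exact: cvg_fst.
  exact: tvs_prod_proj_continuous.
have c2 : (fun z : tvs_prod * tvs_prod => z.2 i) @ x --> x.2 i.
  apply: (@continuous_comp _ _ _ snd (fun y : tvs_prod => y i)); first exact: cvg_snd.
  exact: tvs_prod_proj_continuous.
exact: (cvg_pair c1 c2).
Qed.

Let scale_continuous : continuous (fun z : K^o * tvs_prod => z.1 *: z.2).
Proof.
apply: tvs_prod_continuous => i.
change (continuous ((fun u : K^o * T i => u.1 *: u.2) \o
  (fun x : K^o * tvs_prod => (x.1, x.2 i)))) => x.
apply: continuous_comp; last exact: scale_continuous.
have c2 : (fun z : K^o * tvs_prod => z.2 i) @ x --> x.2 i.
  apply: (@continuous_comp _ _ _ snd (fun y : tvs_prod => y i)); first exact: cvg_snd.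
  exact: tvs_prod_proj_continuous.
exact: (cvg_pair (@cvg_fst _ _ (nbhs x.1) (nbhs x.2) _) c2).
Qed.

Let locally_convex : exists2 B : set_system tvs_prod,
  (forall b, b \in B -> convex_set b) & basis B.
Proof.
apply: open_convex_basis => x.
pose G : set_system tvs_prod :=
  filter_from [set V | open_convex_sets V /\ V x] id.
have GF : Filter G.
  apply: filter_from_filter.
    by exists setT => //; do !split=> //; exact: openT.
  move=> U V [[oU cU] Ux] [[oV cV] Vx]; exists (U `&` V) => //.
  do !split => //; first exact: openI.
  move=> y z l /set_mem[Uy Vy] /set_mem[Uz Vz]; apply/mem_set; split.
    by apply/set_mem/cU; exact/mem_set.
  by apply/set_mem/cV; exact/mem_set.
suff Gx : G --> x.
  by move=> U /Gx[V [oV Vx] VU]; exists V.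
apply/cvg_sup => i U [_ [[W oW <-] Wx] WU].
have [V [oV cV] [Vx VW]] := tvs_open_convex (open_nbhs_nbhs (conj oW Wx)).
exists ((fun y : tvs_prod => y i) @^-1` V); last by move=> y /VW; exact: WU.
split => //; split.
  by apply: open_comp oV => y _; exact: tvs_prod_proj_continuous.
move=> y z l /set_mem Vy /set_mem Vz; apply/mem_set.
exact/set_mem/(cV _ _ l (mem_set Vy) (mem_set Vz)).
Qed.

HB.instance Definition _ :=
  PreTopologicalNmodule_isTopologicalNmodule.Build tvs_prod add_continuous.
HB.instance Definition _ :=
  TopologicalNmodule_isTopologicalLmodule.Build K tvs_prod scale_continuous.
HB.instance Definition _ := Uniform_isTvs.Build K tvs_prod locally_convex.

End tvs_prod.


(* The space [ell_infty R J] of bounded families of complex numbers indexed by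
   an arbitrary, possibly empty, type [J]. The library norm of a module over
   [R[i]] takes its values in [R[i]]; the supremum is taken in [R]. *)
Section ell_infty.
Variables (R : realType) (J : Type).
Import Normc.
Local Open Scope complex_scope.

Definition bounded_family : {pred (J -> R[i]^o)} :=
  fun f => f \in (bounded_fun : set (J -> R[i]^o)).

Lemma bounded_familyP (f : J -> R[i]^o) :
  reflect (exists M : R, forall j, normc (f j) <= M) (f \in bounded_family).
Proof.
apply: (iffP idP) => [|[M fM]].
  rewrite -topredE /= /bounded_family inE => -[M [Mr bM]].
  exists (complex.Re M + 1) => j.
  have MM : M < (complex.Re M + 1)%:C.
    by rewrite -(RRe_real Mr) ltcE /= eqxx /= ltrDl.
  by have := bM _ MM j Logic.I; rewrite -lecR.
rewrite -topredE /= /bounded_family inE; exists M%:C; split.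
  by apply/complex_realP; exists M.
move=> N /ltW MN j _ /=; apply: le_trans MN.
by rewrite -[leLHS]/((normc (f j))%:C) lecR.
Qed.

Lemma bounded_family_submod_closed : submod_closed bounded_family.
Proof.
split=> [|a f g /bounded_familyP[M fM] /bounded_familyP[N gN]].
  by apply/bounded_familyP; exists 0 => j; rewrite normc0.
apply/bounded_familyP; exists (normc a * M + N) => j.
apply: le_trans (le_normcD _ _) _; rewrite lerD//.
rewrite -[X in normc X]/(a * f j) normcM ler_wpM2l//.
by rewrite -lecR; exact: (normr_ge0 (a : R[i])).
Qed.

HB.instance Definition _ := GRing.isSubmodClosed.Build R[i] (J -> R[i]^o)
  bounded_family bounded_family_submod_closed.

Record ell_infty := EllInfty {
  ell_infty_val :> J -> R[i]^o ;
  ell_infty_valP : ell_infty_val \in bounded_family }.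

HB.instance Definition _ := [isSub for ell_infty_val].
HB.instance Definition _ := [Choice of ell_infty by <:].
HB.instance Definition _ := [SubChoice_isSubZmodule of ell_infty by <:].
HB.instance Definition _ := [SubZmodule_isSubLmodule of ell_infty by <:].

Definition ell_infty_sup (x : ell_infty) : R := sup (range (fun j => normc (x j))).

Lemma ell_infty_sup_ub (x : ell_infty) j : normc (x j) <= ell_infty_sup x.
Proof.
apply: ub_le_sup; last by exists j.
have /bounded_familyP[M xM] := ell_infty_valP x.
by exists M => _ [k _ <-].
Qed.

Let normc_ge0 (z : R[i]) : 0 <= normc z.
Proof. by rewrite -lecR; exact: (normr_ge0 z). Qed.

Lemma ell_infty_sup_le (x : ell_infty) (M : R) :
  0 <= M -> (forall j, normc (x j) <= M) -> ell_infty_sup x <= M.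
Proof.
move=> M0 xM; have [J0|/set0P J0] := eqVneq (range (fun j => normc (x j))) set0.
  by rewrite /ell_infty_sup J0 sup0.
by apply: ge_sup => // _ [j _ <-].
Qed.

Lemma ell_infty_sup_ge0 (x : ell_infty) : 0 <= ell_infty_sup x.
Proof.
have [J0|/set0P[_ [j _ _]]] := eqVneq (range (fun j => normc (x j))) set0.
  by rewrite /ell_infty_sup J0 sup0.
exact: le_trans (normc_ge0 _) (ell_infty_sup_ub x j).
Qed.

Definition ell_infty_norm (x : ell_infty) : R[i] := (ell_infty_sup x)%:C.

Let ler_normD x y :
  ell_infty_norm (x + y) <= ell_infty_norm x + ell_infty_norm y.
Proof.
rewrite /ell_infty_norm -rmorphD lecR; apply: ell_infty_sup_le => [|j].
  by rewrite addr_ge0// ell_infty_sup_ge0.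
by apply: le_trans (le_normcD _ _) _; rewrite lerD// ell_infty_sup_ub.
Qed.

Let ell_infty_supZ_le (l : R[i]) x :
  ell_infty_sup (l *: x) <= normc l * ell_infty_sup x.
Proof.
apply: ell_infty_sup_le => [|j]; first by rewrite mulr_ge0// ell_infty_sup_ge0.
rewrite -[X in normc X]/(l * x j) normcM ler_wpM2l//.
exact: ell_infty_sup_ub.
Qed.

Let normrZ (l : R[i]) x : ell_infty_norm (l *: x) = `|l| * ell_infty_norm x.
Proof.
rewrite -[`|l|]/((normc l)%:C) /ell_infty_norm -rmorphM; congr (_ %:C).
apply/eqP; rewrite eq_le ell_infty_supZ_le /=.
have [->|l0] := eqVneq l 0; first by rewrite normc0 mul0r ell_infty_sup_ge0.
have nl0 : 0 < normc l.
  by rewrite lt_neqAle normc_ge0 andbT eq_sym; apply: contra_neq l0 => /eq0_normc.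
have := ell_infty_supZ_le l^-1 (l *: x).
by rewrite scalerA mulVf// scale1r normcV ler_pdivlMl.
Qed.

Let normr0_eq0 x : ell_infty_norm x = 0 -> x = 0.
Proof.
move=> [x0]; apply/val_inj/funext => j; apply: eq0_normc.
by apply/eqP; rewrite eq_le normc_ge0 andbT -x0 ell_infty_sup_ub.
Qed.

HB.instance Definition _ :=
  Lmodule_isNormed.Build R[i] ell_infty ler_normD normrZ normr0_eq0.

Lemma ell_infty_normE (x : ell_infty) :
  `|x| = (sup (range (fun j => normc (x j))))%:C.
Proof. by []. Qed.

End ell_infty.

(* In the following definitions, [X], [Y], [E] are locally convex spaces over
   the complex numbers. Hausdorffness is a separate hypothesis since it is not
   part of [tvsType]. *)
Section lcs.
Variable R : realType.
Local Notation C := R[i].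

Definition lcs_injective (X : tvsType C) : Prop :=
  forall (B : tvsType C) (A : submodClosed B) (f : {linear subtvs A -> X}),
    hausdorff_space B -> continuous f ->
    exists g : {linear B -> X}, continuous g /\ forall a : subtvs A, g (\val a) = f a.

Definition lcs_isomorphic (X Y : tvsType C) : Prop :=
  exists (f : {linear X -> Y}) (g : {linear Y -> X}),
    [/\ cancel f g, cancel g f, continuous f & continuous g].

Definition complemented (E : tvsType C) (F : submodClosed E) : Prop :=
  exists r : {linear E -> subtvs F},
    continuous r /\ forall x : subtvs F, r (\val x) = x.

End lcs.

(* Main.v *)
Require Import Defs.
From HB Require Import structures.
From mathcomp Require Import all_boot all_order all_algebra.
From mathcomp Require Import all_classical all_reals.
From mathcomp Require Import topology normedtype interval_inference wochoice.
From mathcomp Require Import complex ring lra.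

(** Why such products are injective. Products and retracts of injective spaces
are injective ([tvs_prod_injective], [retract_injective]), so it is enough that
the spaces of bounded families are injective. A continuous linear map from a subspace of
[B] into such a space is a family of functionals dominated by a single
continuous seminorm of [B]; extending every functional under that seminorm by
the Hahn-Banach theorem gives a bounded family again, and a continuous map
([ell_infty_injective]).

Why an injective [X] has this form. Evaluating vectors on the functionals
dominated by the various continuous seminorms embeds [X] into a power [L^S] of
one space [L] of bounded families, and injectivity turns this into a retraction
([injective_retract_of_power]). So [X] is the range of a continuous idempotent
[r] of [L^S]. As a normed space has no nonzero subspace inside its unit ball,
each coordinate of [r x] depends on finitely many coordinates of [x]
([finite_dependency]). Every index therefore lies in a countable set of indices
stable under dependency, and a well-order of [S] arranges these sets into a
well-ordered partition of [S] into countable blocks for which [r] is block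
triangular ([ranking_exists]).

The diagonal blocks of [r] are idempotents of countable powers of [L]; their
ranges are the complemented subspaces [F t]. A vector [x] of [X] has a component
in [F t], namely its block [t] minus the block [t] of the image under [r] of its
blocks below [t]. Conversely, any choice of components comes from exactly one
vector of [X], built by transfinite recursion over the blocks. In the product
topology, continuity of that vector in the components is checked coordinate by
coordinate, so it passes through limit stages of the recursion, and [X] is
isomorphic to the product of the [F t] ([slice_decomposition]). *)

Set Implicit Arguments.
Unset Strict Implicit.
Unset Printing Implicit Defensive.

Import Order.TTheory GRing.Theory Num.Theory.
Import numFieldNormedType.Exports.
Import Normc.

Local Open Scope classical_set_scope.
Local Open Scope complex_scope.
Local Open Scope ring_scope.

(** * Linear maps and moduli *)

Lemma linear_function (K : pzRingType) (U V : lmodType K) (f : U -> V) :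
  linear f -> exists g : {linear U -> V}, g =1 f.
Proof.
move=> lf; pose lin := GRing.isLinear.Build _ _ _ _ f lf.
pose g : {linear U -> V} := HB.pack f lin.
by exists g.
Qed.

Section modulus.
Variable R : realType.
Implicit Types z : R[i].

Lemma normc_ge0 z : 0 <= normc z.
Proof. by rewrite -lecR; exact: (normr_ge0 z). Qed.

Lemma normc_real (a : R) : normc a%:C = `|a|.
Proof. by rewrite /= expr0n addr0 sqrtr_sqr. Qed.

Lemma ler_Re_normc z : complex.Re z <= normc z.
Proof.
apply: le_trans (ler_norm _) _; rewrite -lecR.
exact: normc_ge_Re.
Qed.

End modulus.

(** * Hahn-Banach for complex seminorms *)

Section hahn_banach.
Variables (R : realType) (V : lmodType R[i]).
Implicit Types (p : V -> R) (G : set (V * R)).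

Definition seminorm p :=
  (forall x y, p (x + y) <= p x + p y) /\
  (forall c x, p (c *: x) = normc c * p x).

Lemma seminorm_real p t x : seminorm p -> 0 <= t -> p (t%:C *: x) = t * p x.
Proof. by move=> [_ ->] t0; rewrite normc_real ger0_norm. Qed.

Lemma seminorm0 p : seminorm p -> p 0 = 0.
Proof. by move=> [_ pZ]; rewrite -(scale0r (0 : V)) pZ normc0 mul0r. Qed.

Lemma seminorm_ge0 p x : seminorm p -> 0 <= p x.
Proof.
move=> sp; have [pD pZ] := sp.
have := pD x (-1 *: x); rewrite scaleN1r subrr (seminorm0 sp) -scaleN1r pZ.
by rewrite normcN normc1 mul1r; lra.
Qed.

(** Partial real-linear functionals dominated by [p], encoded by their graphs.
Single-valuedness is automatic (see [dominated_graph_fun]), and in this form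
the union of a chain needs no compatibility of domains. *)
Definition dominated_graph p G := [/\ G (0, 0),
  (forall t u v, G u -> G v -> G (t%:C *: u.1 + v.1, t * u.2 + v.2)) &
  (forall u, G u -> u.2 <= p u.1)].

(** Two values at [x] differ by a value at [0], which [p 0 = 0] bounds on both
sides. *)
Lemma dominated_graph_fun p G x v w : seminorm p -> dominated_graph p G ->
  G (x, v) -> G (x, w) -> v = w.
Proof.
move=> sp [_ GL Gp] Gv Gw.
have := Gp _ (GL (-1) _ _ Gv Gw); have := Gp _ (GL (-1) _ _ Gw Gv).
by rewrite /= rmorphN1 scaleN1r addNr (seminorm0 sp); lra.
Qed.

(** The value chosen at [x0] is the supremum of [v - p (x - x0)] over the graph;
subadditivity of [p] places it below all the numbers [p (y + x0) - w]. These
are the two constraints needed, for negative and for positive multiples of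
[x0]. *)
Lemma dominated_graph_step p G x0 : seminorm p -> dominated_graph p G ->
  exists G', [/\ dominated_graph p G', G `<=` G' & exists v, G' (x0, v)].
Proof.
move=> sp [G0 GL Gp]; have [pD pZ] := sp.
have GZ t u : G u -> G (t%:C *: u.1, t * u.2).
  by move=> Gu; have := GL t _ _ Gu G0; rewrite /= !addr0.
pose E := [set u.2 - p (u.1 - x0) | u in G].
have Eub u w : G u -> G w -> u.2 - p (u.1 - x0) <= p (w.1 + x0) - w.2.
  move=> Gu Gw; have := Gp _ (GL 1 _ _ Gu Gw); rewrite /= scale1r mul1r.
  have := pD (u.1 - x0) (w.1 + x0); rewrite addrACA addNr addr0.
  lra.
have E0 : E !=set0 by exists (0 - p (0 - x0)); exists (0, 0).
have Ele u : G u -> u.2 - p (u.1 - x0) <= sup E.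
  move=> Gu; apply: ub_le_sup; last by exists u.
  by exists (p (0 + x0) - 0) => _ [w Gw <-]; exact: (Eub w (0, 0)).
have leE w : G w -> sup E <= p (w.1 + x0) - w.2.
  by move=> Gw; apply: ge_sup => // _ [u Gu <-]; exact: Eub.
exists [set z | exists u t, G u /\ z = (u.1 + t%:C *: x0, u.2 + t * sup E)].
split; last 2 first.
- by move=> [x v] Gu; exists (x, v), 0; rewrite scale0r mul0r !addr0.
- by exists (sup E), (0, 0), 1; rewrite scale1r mul1r !add0r.
split.
- by exists (0, 0), 0; rewrite scale0r mul0r !addr0.
- move=> t _ _ [u [a [Gu ->]]] [w [b [Gw ->]]] /=.
  exists (t%:C *: u.1 + w.1, t * u.2 + w.2), (t * a + b).
  split; first exact: GL.
  rewrite /= rmorphD rmorphM; congr pair; last by ring.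
  by rewrite scalerDr scalerDl scalerA addrACA.
move=> _ [u [t [Gu ->]]] /=.
have [t0|t0|->] := ltrgtP t 0; last by rewrite mul0r scale0r !addr0; exact: Gp.
  have nt0 : 0 < - t by rewrite oppr_gt0.
  have := Ele _ (GZ (- t)^-1 _ Gu); rewrite /= -(ler_pM2l nt0) mulrBr.
  rewrite mulrA divff ?gt_eqF// mul1r -seminorm_real//; last exact: ltW.
  rewrite scalerBr scalerA -rmorphM divff ?gt_eqF// scale1r.
  by rewrite rmorphN scaleNr opprK; lra.
have := leE _ (GZ t^-1 _ Gu); rewrite /= -(ler_pM2l t0) mulrBr.
rewrite mulrA divff ?gt_eqF// mul1r -seminorm_real//; last exact: ltW.
rewrite scalerDr scalerA -rmorphM divff ?gt_eqF// scale1r.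
by lra.
Qed.

Lemma hahn_banach_graph p G : seminorm p -> dominated_graph p G ->
  exists h : V -> R, [/\ (forall t x y, h (t%:C *: x + y) = t * h x + h y),
    (forall x, h x <= p x) & (forall u, G u -> h u.1 = u.2)].
Proof.
move=> sp dG.
(* Zorn's lemma runs over the [H] whose union with [G] is dominated, so that
   the empty chain is bounded too and every maximal element extends [G]. *)
have [F Ftot|H [dH Hmax]] :=
    @Zorn_bigcup _ [set H | dominated_graph p (G `|` H)].
  move=> FF; have [[H0 FH0]|F0] := pselect (exists H, F H); last first.
    rewrite /= (_ : \bigcup_(X in F) X = set0) ?setU0//.
    by apply/seteqP; split=> // u [X FX]; case: F0; exists X.
  have dH0 : dominated_graph p (G `|` H0) := Ftot _ FH0.
  have in_one u v : (G `|` \bigcup_(X in F) X) u ->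
      (G `|` \bigcup_(X in F) X) v ->
      exists X, [/\ F X, (G `|` X) u & (G `|` X) v].
    move=> [Gu|[X FX Xu]] [Gv|[Y FY Yv]].
    - by exists H0; split=> //; left.
    - by exists Y; split=> //; [left|right].
    - by exists X; split=> //; [right|left].
    - have [XY|YX] := FF _ _ FX FY.
        by exists Y; split=> //; right=> //; exact: XY.
      by exists X; split=> //; right=> //; exact: YX.
  split.
  - by left; case: dG.
  - move=> t u v Tu Tv; have [X [FX Xu Xv]] := in_one _ _ Tu Tv.
    have [_ /(_ t _ _ Xu Xv) XL _] := Ftot _ FX.
    by case: XL => [?|?]; [left|right; exists X].
  - move=> u Tu; have [X [FX Xu _]] := in_one _ _ Tu Tu.
    by have [_ _ /(_ _ Xu)] := Ftot _ FX.
pose M := G `|` H; have [M0 ML Mp] : dominated_graph p M := dH.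
have tot x : exists v, M (x, v).
  have [M' [dM' MM' [v M'v]]] := dominated_graph_step x sp dH.
  exists v; apply: contrapT => Mv; apply: (Hmax M').
    split; first by move=> u Hu; apply: MM'; right.
    by move=> M'H; apply: Mv; right; exact: M'H.
  rewrite /= (_ : G `|` M' = M')//; apply/seteqP; split=> u; last by right.
  by case=> // Gu; apply: MM'; left.
have [h hM] := choice tot; exists h; split.
- move=> t x y; apply: dominated_graph_fun sp dH (hM _) _.
  exact: (ML t _ _ (hM x) (hM y)).
- by move=> x; exact: Mp _ (hM x).
- move=> [x v] Gu; apply: dominated_graph_fun sp dH (hM _) _.
  by left.
Qed.

(** A complex functional is determined by its real part [h], as
[h x - i h (i x)]. The bound on [h] passes to the modulus: rotating [x] by a
suitable unit makes the value at [x] real without changing [p x]. *)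
Lemma hahn_banach p G : seminorm p -> dominated_graph p G ->
  exists g : {linear V -> R[i]^o}, (forall x, normc (g x) <= p x) /\
    (forall u, G u -> complex.Re (g u.1) = u.2).
Proof.
move=> sp dG; have [h [hL hp hG]] := hahn_banach_graph sp dG.
have h0 : h 0 = 0 by have := hL 1 0 0; rewrite scaler0 add0r mul1r; lra.
have hD x y : h (x + y) = h x + h y.
  by rewrite -[x]scale1r hL mul1r scale1r.
have hZ t x : h (t%:C *: x) = t * h x by rewrite -[_ *: x]addr0 hL h0 addr0.
have hN x : h (- x) = - h x.
  by have := hD x (- x); rewrite subrr h0; lra.
pose g x : R[i]^o := h x -i* h ('i *: x).
have [|g' g'E] := @linear_function _ V R[i]^o g.
  move=> [a b] x y; rewrite /g.
  have zE (z : V) : (a +i* b) *: z = a%:C *: z + b%:C *: ('i *: z).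
    by rewrite scalerA -scalerDl [_ +i* _]complexE /= [_ * b%:C]mulrC.
  rewrite [X in _ -i* X](_ : _ = h ((a +i* b) *: ('i *: x)) + h ('i *: y)).
    rewrite !zE !hD !hZ [in 'i *: ('i *: x)]scalerA -expr2 sqr_i scaleN1r hN.
    rewrite -[X in _ = X + _]/((a +i* b) * (h x -i* h ('i *: x))).
    by simpc; congr (_ +i* _); ring.
  by rewrite scalerDr hD !scalerA [_ * 'i]mulrC.
exists g'; split=> [x|u /hG <-]; last by rewrite g'E.
have [->|gx0] := eqVneq (normc (g' x)) 0; first exact: seminorm_ge0.
(* The rotation that makes the value real and positive. *)
pose c := (g' x)^-1 * (normc (g' x))%:C.
have cgx : g' (c *: x) = (normc (g' x))%:C.
  rewrite linearZ; change (c * g' x = (normc (g' x))%:C).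
  rewrite /c mulrAC mulVf ?mul1r//.
  by apply: contra_neq gx0 => ->; rewrite normc0.
have -> : normc (g' x) = h (c *: x).
  by have := congr1 (@complex.Re R) cgx; rewrite g'E.
apply: le_trans (hp _) _; have [_ ->] := sp.
rewrite normcM normcV normc_real ger0_norm ?normc_ge0// mulVf// mul1r//.
Qed.

(** Starts the extension on the real line spanned by [x0], with value [p x0] at
[x0]. *)
Lemma hahn_banach_norming p x0 : seminorm p ->
  exists g : {linear V -> R[i]^o}, (forall x, normc (g x) <= p x) /\
    p x0 <= normc (g x0).
Proof.
move=> sp.
have [|g [gp gG]] := @hahn_banach p [set (t%:C *: x0, t * p x0) | t in setT] sp.
  split.
  - by exists 0 => //; rewrite scale0r mul0r.
  - move=> t _ _ [a _ <-] [b _ <-] /=; exists (t * a + b) => //.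
    by rewrite rmorphD rmorphM scalerDl scalerA mulrDl mulrA.
  - move=> _ [t _ <-] /=; have [_ ->] := sp.
    by rewrite normc_real ler_wpM2r ?ler_norm// seminorm_ge0.
exists g; split=> //; apply: le_trans (ler_Re_normc _).
by rewrite (gG (x0, p x0)) //; exists 1 => //; rewrite scale1r mul1r.
Qed.

End hahn_banach.

Section hahn_banach_subspace.
Variables (R : realType) (U V : lmodType R[i]).

(** Only the real part of [f] is extended; the imaginary part follows because
[Im z = - Re (i z)]. *)
Lemma hahn_banach_extension (i : {linear U -> V}) (f : {linear U -> R[i]^o})
    (p : V -> R) : seminorm p -> (forall u, normc (f u) <= p (i u)) ->
  exists g : {linear V -> R[i]^o}, (forall x, normc (g x) <= p x) /\
    (forall u, g (i u) = f u).
Proof.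
move=> sp fp.
have [|g [gp gG]] :=
    @hahn_banach R V p [set (i u, complex.Re (f u)) | u in setT] sp.
  split.
  - by exists 0 => //; rewrite !linear0.
  - move=> t _ _ [u _ <-] [v _ <-] /=; exists (t%:C *: u + v) => //.
    rewrite !linearP; congr pair; case: (f u) => a b; case: (f v) => c d.
    by rewrite /= mul0r subr0.
  - move=> _ [u _ <-] /=; exact: le_trans (ler_Re_normc _) (fp u).
exists g; split=> // u.
have gRe v : complex.Re (g (i v)) = complex.Re (f v).
  by rewrite (gG (i v, complex.Re (f v)))//; exists v.
have := gRe ('i *: u); have := gRe u; rewrite !linearZ.
case: (f u) => a b; case: (g (i u)) => c d /=.
by rewrite !mul0r !sub0r !mul1r => -> /oppr_inj ->.
Qed.

End hahn_banach_subspace.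

(** * Neighbourhoods of zero and continuous seminorms *)

Lemma linear_continuous_at0 (K : numFieldType) (E F : tvsType K)
    (f : {linear E -> F}) :
  (forall U, nbhs (0 : F) U -> nbhs (0 : E) (f @^-1` U)) -> continuous f.
Proof.
move=> f0 x U fxU.
have := nbhsB (- f x) fxU; rewrite addNr => /f0 /(nbhsT x).
apply: filterS => _ [y [z Uz fyz] <-] /=.
by rewrite linearD -fyz addNKr.
Qed.

Lemma nbhs0_pullback (K : numFieldType) (E F : tvsType K) (f : {linear E -> F}) U :
  continuous f -> nbhs (0 : F) U -> nbhs (0 : E) (f @^-1` U).
Proof. by move=> cf U0; apply: cf; rewrite linear0. Qed.

Section seminorms.
Variable R : realType.

Lemma nbhs0_normc (A : set R[i]^o) : nbhs (0 : R[i]^o) A ->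
  exists2 d : R, 0 < d & forall c, normc c < d -> A c.
Proof.
move=> /nbhs_norm0P[e /= e0 eA]; exists (complex.Re e).
  by move: e0; rewrite ltcE => /andP[].
move=> c cd; apply: eA => /=.
by rewrite -(RRe_real (gtr0_real e0)) -[`|c|]/((normc c)%:C) ltcR.
Qed.

(** Continuity of a seminorm is equivalent to its open unit ball being a
neighbourhood of zero, which is the form used throughout. *)
Definition continuous_seminorm (E : tvsType R[i]) (p : E -> R) :=
  seminorm p /\ nbhs (0 : E) [set x | p x < 1].

(** The Minkowski functional of an absolutely convex neighbourhood of zero. *)
Section gauge.
Variables (E : tvsType R[i]) (W : set E).
Hypothesis W0 : nbhs (0 : E) W.
Hypothesis Wconvex : forall (a b : R) x y, 0 <= a -> 0 <= b -> a + b = 1 ->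
  W x -> W y -> W (a%:C *: x + b%:C *: y).
Hypothesis Wbalanced : forall c x, normc c <= 1 -> W x -> W (c *: x).

Let dilations x := [set t : R | 0 < t /\ W (t^-1%:C *: x)].
Let gauge x := inf (dilations x).

Let dilations_neq0 x : dilations x !=set0.
Proof.
have := @scale_continuous _ E (0, x) W; rewrite /= scale0r => /(_ W0).
move=> [[A B] /= [/nbhs0_normc[d d0 dA] /nbhs_singleton Bx] AB].
have dW c : normc c < d -> W (c *: x) by move=> /dA Ac; exact: (AB (c, x)).
exists (d / 2)^-1; split; first by rewrite invr_gt0; lra.
by apply: dW; rewrite invrK normc_real ger0_norm; lra.
Qed.

Let dilations_lb x : has_lbound (dilations x).
Proof. by exists 0 => t [/ltW]. Qed.

Let gauge_le x t : 0 < t -> W (t^-1%:C *: x) -> gauge x <= t.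
Proof. by move=> t0 Wt; exact: (inf_lbound (dilations_lb x)). Qed.

Let gauge_lt x e : gauge x < e -> exists2 t, dilations x t & t < e.
Proof. by move=> /(inf_lt (dilations_neq0 x)). Qed.

Let gauge_ge0 x : 0 <= gauge x.
Proof. by apply: lb_le_inf => // t [/ltW]. Qed.

Let gaugeD x y : gauge (x + y) <= gauge x + gauge y.
Proof.
apply/ler_addgt0Pr => e e0.
have [|s [s0 Ws] se] := @gauge_lt x (gauge x + e / 2); first by lra.
have [|t [t0 Wt] te] := @gauge_lt y (gauge y + e / 2); first by lra.
apply: (@le_trans _ _ (s + t)); last by lra.
have st : s + t != 0 by rewrite gt_eqF// addr_gt0.
apply: gauge_le; first by rewrite addr_gt0.
have := @Wconvex (s / (s + t)) (t / (s + t)) _ _ _ _ _ Ws Wt.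
rewrite !scalerA -!rmorphM ![_ / (s + t) / _]mulrAC !divff ?gt_eqF// !mul1r.
rewrite -scalerDr; apply; last by rewrite -mulrDl divff.
- by rewrite divr_ge0// ltW// addr_gt0.
- by rewrite divr_ge0// ltW// addr_gt0.
Qed.

Let gaugeZ_le c x : gauge (c *: x) <= normc c * gauge x.
Proof.
have [->|c0] := eqVneq c 0.
  rewrite normc0 mul0r scale0r; apply/ler_addgt0Pr => e e0; rewrite add0r.
  by apply: gauge_le => //; rewrite scaler0; exact: nbhs_singleton.
have nc0 : 0 < normc c.
  by rewrite lt_neqAle normc_ge0 andbT eq_sym; apply: contra_neq c0 => /eq0_normc.
rewrite -ler_pdivrMl//; apply: lb_le_inf => // t [t0 Wt].
rewrite ler_pdivrMl//; apply: gauge_le; first exact: mulr_gt0.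
have -> : (normc c * t)^-1%:C *: (c *: x) = (c / (normc c)%:C) *: (t^-1%:C *: x).
  by rewrite !scalerA invfM rmorphM fmorphV; congr (_ *: _); ring.
apply: Wbalanced => //.
by rewrite normcM normcV normc_real ger0_norm ?mulfV ?gt_eqF// ltW.
Qed.

Lemma gauge_continuous_seminorm :
  continuous_seminorm gauge /\ [set x | gauge x < 1] `<=` W.
Proof.
split; last first.
  move=> x /gauge_lt[t [t0 Wt] t1].
  have -> : x = t%:C *: (t^-1%:C *: x).
    by rewrite scalerA -rmorphM divff ?gt_eqF// scale1r.
  by apply: Wbalanced Wt; rewrite normc_real ger0_norm// ltW.
split; last first.
  apply: filterS (nbhs0Z (_ : 2^-1 != 0) W0); last by rewrite invr_eq0 pnatr_eq0.
  move=> _ [x Wx <-] /=; apply: (@le_lt_trans _ _ (2^-1)); last by lra.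
  apply: gauge_le; first by lra.
  by rewrite invrK scalerA rmorphMn rmorph1 mulfV ?scale1r// pnatr_eq0.
split; first exact: gaugeD.
move=> c x; apply/eqP; rewrite eq_le gaugeZ_le /=.
have [->|c0] := eqVneq c 0; first by rewrite normc0 mul0r gauge_ge0.
have nc0 : 0 < normc c.
  by rewrite lt_neqAle normc_ge0 andbT eq_sym; apply: contra_neq c0 => /eq0_normc.
have := gaugeZ_le c^-1 (c *: x).
by rewrite scalerA mulVf// scale1r normcV ler_pdivlMl.
Qed.

End gauge.

(** Local convexity only yields convex neighbourhoods [V]; the vectors all of
whose multiples by scalars of modulus at most one lie in [V] form a balanced
one, whose gauge is the seminorm. *)
Lemma nbhs0_seminorm (E : tvsType R[i]) (U : set E) : nbhs (0 : E) U ->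
  exists p, continuous_seminorm p /\ [set x | p x < 1] `<=` U.
Proof.
move=> /tvs_open_convex[V [oV cV] [V0 VU]].
have {}cV (a b : R) x y : 0 <= a -> 0 <= b -> a + b = 1 ->
    V x -> V y -> V (a%:C *: x + b%:C *: y).
  move=> a0 b0 ab1 /mem_set Vx /mem_set Vy.
  have a0C : 0 <= a%:C by rewrite ler0c.
  have a1C : a%:C <= 1 by rewrite -(rmorph1 (real_complex R)) lecR; lra.
  have /set_mem : a%:C *: x + (1 - a%:C) *: y \in V := cV x y (Itv01 a0C a1C) Vx Vy.
  by rewrite -(rmorph1 (real_complex R)) -rmorphB -ab1 addrAC subrr add0r.
pose W := [set x | forall c, normc c <= 1 -> V (c *: x)].
have W0 : nbhs (0 : E) W.
  have := @scale_continuous _ E (0, 0) V; rewrite /= scaler0.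
  move=> /(_ (open_nbhs_nbhs (conj oV V0)))[[A B] /= [A0 B0] AB].
  have [d d0 dA] := nbhs0_normc A0.
  have d20 : (d / 2)%:C != 0 :> R[i].
    by rewrite fmorph_eq0 gt_eqF//; lra.
  apply: filterS (nbhs0Z d20 B0) => _ [y By <-] c c1.
  rewrite scalerA; apply: (AB (c * (d / 2)%:C, y)); split=> //=.
  apply: dA; rewrite normcM normc_real ger0_norm; last by lra.
  apply: (@le_lt_trans _ _ (1 * (d / 2))); last by lra.
  by rewrite ler_wpM2r//; lra.
have [||cp pW] := gauge_continuous_seminorm W0.
- move=> a b x y a0 b0 ab1 Wx Wy c c1.
  rewrite scalerDr !scalerA ![c * _]mulrC -!scalerA.
  by apply: cV => //; [exact: Wx|exact: Wy].
- move=> c x c1 Wx b b1; rewrite scalerA; apply: Wx; rewrite normcM.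
  by rewrite -[1]mulr1 ler_pM// ?normc_ge0.
eexists; split; first exact: cp.
move=> x /pW /(_ 1); rewrite normc1 scale1r => /(_ (lexx _)) Vx.
exact: VU.
Qed.

(** Inclusion of unit balls gives domination, by homogeneity. *)
Lemma seminorm_bound (E : lmodType R[i]) (p q : E -> R) :
  seminorm p -> seminorm q -> (forall x, p x < 1 -> q x <= 1) ->
  forall x, q x <= p x.
Proof.
move=> sp sq pq x; apply/ler_addgt0Pr => e e0.
have pxe : 0 < p x + e by rewrite ltr_wpDl// seminorm_ge0.
have := pq ((p x + e)^-1%:C *: x).
rewrite !seminorm_real// ?invr_ge0 ?(ltW pxe)//.
rewrite mulrC ltr_pdivrMr// mul1r mulrC ler_pdivrMr// mul1r; apply.
by lra.
Qed.

Lemma separate_seminorm (E : tvsType R[i]) (x : E) : hausdorff_space E ->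
  (forall p, continuous_seminorm p -> p x = 0) -> x = 0.
Proof.
move=> hE px; apply: hE => A B xA B0.
have [p [cp pB]] := nbhs0_seminorm B0.
by exists x; split; [exact: nbhs_singleton|apply: pB; rewrite /= px].
Qed.

End seminorms.

(** * Injectivity of the spaces of bounded families *)

Section ell_infty_maps.
Variable R : realType.

Lemma continuous_seminorm_lt (E : tvsType R[i]) (p : E -> R) e :
  continuous_seminorm p -> 0 < e -> nbhs (0 : E) [set x | p x < e].
Proof.
move=> [sp p1] e0; have e0C : e%:C != 0 :> R[i] by rewrite fmorph_eq0 gt_eqF.
apply: filterS (nbhs0Z e0C p1) => _ [x /= px <-].
by rewrite (seminorm_real _ sp (ltW e0)) -ltr_pdivlMl// mulVf// gt_eqF.
Qed.

Lemma ell_infty_bounded_continuous (E : tvsType R[i]) J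
    (f : {linear E -> ell_infty R J}) (p : E -> R) :
  continuous_seminorm p -> (forall x j, normc (f x j) <= p x) -> continuous f.
Proof.
move=> cp fp; apply: linear_continuous_at0 => U /nbhs_norm0P[e /= e0 eU].
have re0 : 0 < complex.Re e by move: e0; rewrite ltcE => /andP[].
apply: filterS (continuous_seminorm_lt cp re0) => x /= pxe; apply: eU => /=.
rewrite -(RRe_real (gtr0_real e0)) -[`|f x|]/((ell_infty_sup (f x))%:C) ltcR.
apply: le_lt_trans pxe; apply: ell_infty_sup_le => //.
by case: cp => /seminorm_ge0.
Qed.

Lemma ell_infty_sup_seminorm J : seminorm (@ell_infty_sup R J).
Proof.
split=> [x y|c x].
  by rewrite -lecR rmorphD; exact: (ler_normD x y).
apply: complexI; rewrite rmorphM; exact: (normrZ c x).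
Qed.

Lemma ell_infty_sup_continuous_seminorm (E : tvsType R[i]) J
    (f : {linear E -> ell_infty R J}) :
  continuous f -> continuous_seminorm (fun x => ell_infty_sup (f x)).
Proof.
have [supD supZ] := ell_infty_sup_seminorm J.
move=> cf; split; first by split=> *; rewrite (linearD, linearZ) (supD, supZ).
apply: (nbhs0_pullback (U := [set y | ell_infty_sup y < 1]) cf).
apply: (nbhs_norm0P (V := ell_infty R J)).2; exists 1 => //= y /=.
by rewrite -[`|y|]/((ell_infty_sup y)%:C) -(rmorph1 (real_complex R)) ltcR.
Qed.

Lemma ell_infty_hausdorff J : hausdorff_space (ell_infty R J).
Proof. exact: norm_hausdorff. Qed.

End ell_infty_maps.

Section injectives.
Variable R : realType.

(** The unit ball of [q] contains the trace of a neighbourhood of zero of [B],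
hence that of the unit ball of a continuous seminorm of [B]. *)
Lemma subtvs_continuous_seminorm (B : tvsType R[i]) (A : submodClosed B)
    (q : subtvs A -> R) : continuous_seminorm q ->
  exists p, continuous_seminorm p /\ forall a, q a <= p (\val a).
Proof.
move=> [sq [_ [[W oW <-] W0 Wq]]].
have [p [cp pW]] := nbhs0_seminorm (open_nbhs_nbhs (conj oW W0)).
exists p; split=> //; case: cp => sp _; have [pD pZ] := sp.
apply: (seminorm_bound (p := p \o \val)) => //.
  by split=> [x y|c x]; [exact: pD|exact: pZ].
by move=> a /pW Wa; exact: ltW (Wq a Wa).
Qed.

(** All coordinates of [f] are dominated by one seminorm [p] of [B]. Extending
each of them under [p] keeps the extensions uniformly bounded at every point
of [B] and continuous as a map into the supremum norm. *)
Lemma ell_infty_injective J : lcs_injective (ell_infty R J).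
Proof.
move=> B A f hB cf.
have [p [cp fp]] :=
  subtvs_continuous_seminorm (ell_infty_sup_continuous_seminorm cf).
have ext j : exists g : {linear B -> R[i]^o}, (forall x, normc (g x) <= p x) /\
    (forall a : subtvs A, g (\val a) = f a j).
  have [|fj fjE] := @linear_function _ (subtvs A) R[i]^o (fun a => f a j).
    by move=> c x y; rewrite linearP.
  have [||g [gp gf]] := @hahn_banach_extension R _ _ \val fj p.
  - by case: cp.
  - by move=> a; rewrite fjE; apply: le_trans (fp a); exact: ell_infty_sup_ub.
  by exists g; split=> // a; rewrite -fjE; exact: gf.
have [g gP] := choice ext.
have gb x : (fun j => g j x) \in @bounded_family R J.
  by apply/bounded_familyP; exists (p x) => j; exact: (gP j).1.
have [|G GE] := @linear_function _ B (ell_infty R J) (fun x => EllInfty (gb x)).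
  move=> c x y; apply/val_inj/funext => j /=; exact: linearP.
exists G; split.
  by apply: (ell_infty_bounded_continuous cp) => x j; rewrite GE; exact: (gP j).1.
by move=> a; rewrite GE; apply/val_inj/funext => j /=; have [_ ->] := gP j.
Qed.

Lemma tvs_prod_injective (I : Type) (T : I -> tvsType R[i]) :
  (forall i, lcs_injective (T i)) -> lcs_injective (tvs_prod T).
Proof.
move=> injT B A f hB cf.
have ext i : exists g : {linear B -> T i}, continuous g /\
    forall a : subtvs A, g (\val a) = f a i.
  have [|fi fiE] := @linear_function _ (subtvs A) (T i) (fun a => f a i).
    by move=> c x y; rewrite linearP.
  have [|g [cg gf]] := injT i B A fi hB.
    rewrite (funext fiE) => x.
    apply: (@continuous_comp _ _ _ f (fun y : tvs_prod T => y i)).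
      exact: cf.
    exact: tvs_prod_proj_continuous.
  by exists g; split=> // a; rewrite gf fiE.
pose g i := sval (cid (ext i)).
have gP i : continuous (g i) /\ forall a : subtvs A, g i (\val a) = f a i :=
  svalP (cid (ext i)).
have [|G GE] := @linear_function _ B (tvs_prod T) (fun x i => g i x).
  by move=> c x y; apply: functional_extensionality_dep => i; exact: linearP.
exists G; split.
  rewrite (funext GE); apply: tvs_prod_continuous => i; exact: (gP i).1.
move=> a; rewrite GE; apply: functional_extensionality_dep => i; exact: (gP i).2.
Qed.

Lemma retract_injective (X Y : tvsType R[i]) (i : {linear Y -> X})
    (q : {linear X -> Y}) : continuous i -> continuous q -> cancel i q ->
  lcs_injective X -> lcs_injective Y.
Proof.
move=> ci cq iK injX B A f hB cf.
have [|g [cg gf]] := injX B A (i \o f) hB.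
  by move=> x; apply: continuous_comp; [exact: cf|exact: ci].
exists (q \o g); split.
  by move=> x; apply: continuous_comp; [exact: cg|exact: cq].
by move=> a; rewrite /= gf /= iK.
Qed.

End injectives.

(** * Injective spaces as retracts of powers *)

Section embedding.
Variables (R : realType) (X : tvsType R[i]).

Definition dual_ball (p : X -> R) (phi : X -> R[i]^o) :=
  [/\ continuous_seminorm p, linear phi & forall x, normc (phi x) <= p x].

(** Evaluation at [x] on the functionals dominated by [p], extended by zero to
all functions on [X], and zero when [p] is not a continuous seminorm. With this
convention the index type does not depend on [p], so that [X] embeds into a
power of a single space. *)
Definition polar_value x p phi : R[i]^o := if `[< dual_ball p phi >] then phi x else 0.

Lemma polar_value_bounded x p :
  polar_value x p \in @bounded_family R (X -> R[i]^o).
Proof.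
apply/bounded_familyP; exists `|p x| => phi; rewrite /polar_value.
case: asboolP => [[_ _ phip]|_]; last by rewrite normc0.
exact: le_trans (phip x) (ler_norm _).
Qed.

Definition seminorm_product :=
  tvs_prod (fun _ : X -> R => ell_infty R (X -> R[i]^o)).

(** Lower bounds for the coordinates come from the functionals attaining [p x],
so that the topology of [X] is the one induced by the embedding. *)
Lemma seminorm_embedding : exists e : {linear X -> seminorm_product},
  continuous e /\
  (forall p x, continuous_seminorm p -> p x <= ell_infty_sup (e x p)).
Proof.
pose e0 x : seminorm_product := fun p => EllInfty (polar_value_bounded x p).
have e0L : linear e0.
  move=> c x y; apply: functional_extensionality_dep => p; apply/val_inj/funext => phi.
  rewrite /= -[RHS]/(c *: polar_value x p phi + polar_value y p phi) /polar_value.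
  by case: asboolP => [[_ phiL _]|_]; rewrite ?phiL// scaler0 addr0.
have [e eE] := linear_function e0L; exists e; split.
  rewrite (funext eE); apply: tvs_prod_continuous => p.
  have [|ep epE] := @linear_function _ X (ell_infty R _) (fun x => e0 x p).
    by move=> c x y; rewrite e0L.
  rewrite -(funext epE); have [cp|np] := pselect (continuous_seminorm p).
    apply: (ell_infty_bounded_continuous cp) => x phi; rewrite epE /= /polar_value.
    case: asboolP => [[_ _ phip]|_]; first exact: phip.
    by rewrite normc0; case: cp => /seminorm_ge0.
  rewrite (_ : (ep : X -> _) = fun=> 0); first by move=> x; exact: cvg_cst.
  apply/funext => x; rewrite epE; apply/val_inj/funext => phi /=.
  by rewrite /polar_value; case: asboolP => // -[].
move=> p x cp; have [g [gp px]] := hahn_banach_norming x cp.1.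
apply: le_trans px _; rewrite eE.
have := @ell_infty_sup_ub _ _ (e0 x p) g; rewrite /= /polar_value.
case: asboolP => // -[]; split=> //; exact: linearP.
Qed.

(** The inverse of the embedding, defined on its image, extends to the whole
power by injectivity of [X]. *)
Lemma injective_retract_of_power : hausdorff_space X -> lcs_injective X ->
  exists (e : {linear X -> seminorm_product}) (q : {linear seminorm_product -> X}),
    [/\ continuous e, continuous q & cancel e q].
Proof.
move=> hX injX; have [e [ce ep]] := seminorm_embedding.
have einj : injective e.
  move=> x y exy; apply/eqP; rewrite -subr_eq0; apply/eqP.
  apply: separate_seminorm => // p cp; apply/eqP.
  rewrite eq_le (seminorm_ge0 _ cp.1) andbT; apply: le_trans (ep _ _ cp) _.
  rewrite linearB exy subrr (_ : (0 : seminorm_product) p = 0)//.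
  by rewrite (seminorm0 (ell_infty_sup_seminorm _ _)).
pose A0 : {pred seminorm_product} := fun y => `[< exists x, e x = y >].
have A0c : submod_closed A0.
  split=> [|c _ _ /asboolP[x <-] /asboolP[y <-]].
    by apply/asboolP; exists 0; rewrite linear0.
  by apply/asboolP; exists (c *: x + y); rewrite linearP.
pose Amix := GRing.isSubmodClosed.Build _ _ A0 A0c.
pose A : submodClosed seminorm_product := HB.pack A0 Amix.
have inv (a : subtvs A) : exists x, e x = \val a.
  by case: a => y /= /asboolP.
have [f0 f0E] := choice inv.
have [|f fE] := @linear_function _ (subtvs A) X f0.
  by move=> c x y; apply: einj; rewrite linearP !f0E linearP.
have [||q [cq qf]] := injX _ A f.
- by apply: tvs_prod_hausdorff => p; exact: ell_infty_hausdorff.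
- apply: linear_continuous_at0 => U /nbhs0_seminorm[p [cp pU]].
  have : nbhs (0 : subtvs A) [set a | ell_infty_sup ((\val a : seminorm_product) p) < 1].
    have [|h hE] := @linear_function _ (subtvs A) (ell_infty R (X -> R[i]^o))
        (fun a => (\val a : seminorm_product) p).
      by move=> c x y; rewrite linearP.
    have ch : continuous h.
      rewrite (funext hE) => a.
      apply: (@continuous_comp _ _ _ (\val : subtvs A -> seminorm_product)
        (fun y : seminorm_product => y p)); first exact: subtvs_val_continuous.
      exact: tvs_prod_proj_continuous.
    have [_] := ell_infty_sup_continuous_seminorm ch.
    by apply: filterS => a /=; rewrite hE.
  apply: filterS => a /= a1; apply: pU => /=.
  by rewrite fE; apply: le_lt_trans (ep _ _ cp) _; rewrite f0E.
exists e, q; split=> // x.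
have Aex : e x \in subtvs_pred A by apply/asboolP; exists x.
have := qf (SubTvs Aex); rewrite fE /= => ->.
by apply: einj; rewrite f0E.
Qed.

End embedding.

(** * Ranking indices by countable dependency-closed sets *)

(** Let [C t] be the set of indices reached from [t] by iterating the dependency
[D]; it is countable and stable under [D]. The rank of [s] is the least [t],
for some well-order, with [s] in [C t]. Everything that [s] depends on also
lies in [C (rank s)], so its rank is no larger; and the indices of rank [t]
all lie in [C t], which [d t] enumerates. *)
Lemma ranking_exists (S : eqType) (D : S -> seq S) :
  exists (le : rel S) (rank : S -> S) (d : S -> nat -> S),
  [/\ total_order le, well_founded (fun s t => ~~ le t s),
      (forall s s', s' \in D s -> le (rank s') (rank s)) &
      forall s, exists n, d (rank s) n = s].
Proof.
have [le wo_le] := well_ordering_principle S.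
have wo_chain_le : wo_chain le predT := withinW wo_le.
have le_refl : reflexive le by move=> s; apply: (wo_chain_reflexive wo_chain_le).
have le_anti : antisymmetric le.
  by move=> s t; apply: (wo_chain_antisymmetric wo_chain_le).
have le_total : total le by move=> s t; apply: (wo_chainW wo_chain_le).
have minimum (Q : S -> Prop) : (exists s, Q s) ->
    exists2 m, Q m & forall s, Q s -> le m s.
  move=> [s Qs]; have [|m [[Qm mQ] _]] := wo_le [pred t | `[< Q t >]].
    by exists s; exact/asboolP.
  by exists m; [exact/asboolP|move=> t Qt; apply: mQ; exact/asboolP].
have le_trans : transitive le.
  move=> y x z xy yz; have [|m] := minimum (fun s => [\/ s = x, s = y | s = z]).
    by exists x; constructor 1.
  case=> -> lem.
  - by apply: lem; constructor 3.
  - by rewrite (le_anti x y) ?yz// xy lem//; constructor 1.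
  - by rewrite -(le_anti y z) ?xy// yz lem//; constructor 2.
(* The indices reached from [t] in exactly [k] steps, a finite list. *)
pose level t := fix level k :=
  if k is k'.+1 then flatten [seq D s | s <- level k'] else [:: t].
pose C t s := exists k, s \in level t k.
have CD t s s' : C t s -> s' \in D s -> C t s'.
  move=> [k sk] s's; exists k.+1; apply/flattenP; exists (D s) => //.
  exact: map_f.
have rank_ex s : exists t, C t s /\ forall t', C t' s -> le t t'.
  have [|t Ct tC] := minimum (C^~ s); last by exists t.
  by exists s, 0; rewrite mem_head.
have [rank rankP] := choice rank_ex.
(* The integer [n] codes a step count and a position; out of range, the
   value is [t]. *)
pose d t n := let ki := odflt (0, 0)%N (unpickle n) in nth t (level t ki.1) ki.2.
exists le, rank, d; split.
- by do !split.
- move=> s; apply: contrapT => ns.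
  have [|m nm mn] := minimum (fun s => ~ Acc (fun s t => ~~ le t s) s).
    by exists s.
  apply: nm; constructor => y ym; apply: contrapT => ny.
  by move: ym; rewrite mn.
- move=> s s' s's; apply: (rankP s').2; exact: CD (rankP s).1 s's.
- move=> s; have [k sk] := (rankP s).1.
  exists (pickle (k, index s (level (rank s) k))).
  by rewrite /d pickleK /= nth_index.
Qed.

(** Well-founded recursion in which [step] takes a total function but reads it
only below its argument. The default [t0] fills the values not yet defined. *)
Lemma wf_fixpoint (A T : Type) (t0 : T) (lt : A -> A -> Prop)
    (step : (A -> T) -> A -> T) : well_founded lt ->
  (forall s x y, (forall s', lt s' s -> x s' = y s') -> step x s = step y s) ->
  exists x, forall s, x s = step x s.
Proof.
move=> wf step_local.
pose below s (x : forall s', lt s' s -> T) s' :=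
  if pselect (lt s' s) is left h then x s' h else t0.
pose F s x := step (@below s x) s.
exists (Fix wf (fun=> T) F) => s; rewrite Fix_eq; last first.
  move=> s1 x y xy; congr (step _ s1); apply/funext => s'.
  by rewrite /below; case: pselect.
by apply: step_local => s' s's; rewrite /below; case: pselect.
Qed.

Lemma tvs_continuousD (K : numFieldType) (Z : topologicalType) (E : tvsType K)
    (f g : Z -> E) : continuous f -> continuous g ->
  continuous (fun z => f z + g z).
Proof.
move=> cf cg z; apply: (@continuous_comp _ _ _ (fun z => (f z, g z))
  (fun u : E * E => u.1 + u.2)); last exact: add_continuous.
exact: cvg_pair (cf z) (cg z).
Qed.

(** * Splitting a retract of a power along a ranking *)

(** [X] is the range of the idempotent [r] of the power [L^S], and [r] is block
triangular: coordinate [s] of [r x] reads only the coordinates of [x] of rank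
at most [rank s]. The blocks are the level sets of the rank. *)
Section decomposition.
Variables (K : numFieldType) (L : tvsType K) (S : eqType).
Local Notation P := (tvs_prod (fun _ : S => L)).
Local Notation Q := (tvs_prod (fun _ : nat => L)).
Variables (X : tvsType K) (e : {linear X -> P}) (q : {linear P -> X}).
Hypotheses (e_cont : continuous e) (q_cont : continuous q) (eK : cancel e q).
Variables (le : rel S) (rank : S -> S) (d : S -> nat -> S) (c : S -> nat).
Hypotheses (le_order : total_order le)
  (le_wf : well_founded (fun s t => ~~ le t s)).
Hypothesis dcK : forall s, d (rank s) (c s) = s.

Let r x := e (q x).

Hypothesis r_local : forall s x, (forall s', le (rank s') (rank s) -> x s' = 0) ->
  r x s = 0.

Let rD x y : r (x + y) = r x + r y. Proof. by rewrite /r !linearD. Qed.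
Let rB x y : r (x - y) = r x - r y. Proof. by rewrite /r !linearB. Qed.
Let rr x : r (r x) = r x. Proof. by rewrite /r eK. Qed.
Let r_cont : continuous r.
Proof. by move=> x; apply: continuous_comp; [exact: q_cont|exact: e_cont]. Qed.

Let r_ext s x y : (forall s', le (rank s') (rank s) -> x s' = y s') ->
  r x s = r y s.
Proof.
move=> xy; apply/eqP; rewrite -subr_eq0; apply/eqP.
rewrite -[LHS]/((r x - r y) s) -rB; apply: r_local => s' /xy xys'.
by rewrite -[LHS]/(x s' - y s') xys' subrr.
Qed.

Let le_refl : reflexive le. Proof. by case: le_order => -[[]]. Qed.
Let le_trans : transitive le. Proof. by case: le_order => -[[]]. Qed.
Let le_anti : antisymmetric le. Proof. by case: le_order => -[]. Qed.

Let le_ltP s t : le s t -> s = t \/ ~~ le t s.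
Proof.
by move=> st; case: (boolP (le t s)) => [ts|]; [left; apply: le_anti; rewrite st|right].
Qed.

Let rank_wf : well_founded (fun s s' => ~~ le (rank s') (rank s)).
Proof.
move=> s; move: {2}(rank s) (eqxx (rank s)) => t.
elim/(well_founded_ind le_wf): t s => t IH s /eqP st; constructor => s'.
by rewrite st => /IH; apply.
Qed.

(** [lower t] keeps the coordinates of rank below [t]. [slice t] and [insert t]
exchange the coordinates of rank [t] with a sequence, along the enumeration
[d t]. The enumeration may repeat indices, so [slice t \o insert t] need not be
the identity; only [insert t \o slice t] has to be the restriction to the
block. *)
Definition lower t (x : P) : P := fun s => if le t (rank s) then 0 else x s.
Definition slice t (x : P) : Q :=
  fun n => if rank (d t n) == t then x (d t n) else 0.
Definition insert t (u : Q) : P := fun s => if rank s == t then u (c s) else 0.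

Lemma lower_linear t : linear (lower t).
Proof.
move=> a x y; apply/funext => s.
rewrite -[RHS]/(a *: lower t x s + lower t y s) /lower.
by case: ifP; rewrite // scaler0 addr0.
Qed.

Lemma slice_linear t : linear (slice t).
Proof.
move=> a x y; apply/funext => n.
rewrite -[RHS]/(a *: slice t x n + slice t y n) /slice.
by case: ifP; rewrite // scaler0 addr0.
Qed.

Lemma insert_linear t : linear (insert t).
Proof.
move=> a x y; apply/funext => n.
rewrite -[RHS]/(a *: insert t x n + insert t y n) /insert.
by case: ifP; rewrite // scaler0 addr0.
Qed.

HB.instance Definition _ t := GRing.isLinear.Build K P P _ (lower t) (lower_linear t).
HB.instance Definition _ t := GRing.isLinear.Build K P Q _ (slice t) (slice_linear t).
HB.instance Definition _ t := GRing.isLinear.Build K Q P _ (insert t) (insert_linear t).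

Lemma slice_continuous t : continuous (slice t).
Proof.
apply: tvs_prod_continuous => n; rewrite /slice; case: (rank (d t n) == t) => /=.
  exact: tvs_prod_proj_continuous.
exact: (@cst_continuous _ L 0).
Qed.

Lemma insert_continuous t : continuous (insert t).
Proof.
apply: tvs_prod_continuous => n; rewrite /insert; case: (rank n == t) => /=.
  exact: tvs_prod_proj_continuous.
exact: (@cst_continuous _ L 0).
Qed.

Lemma lower_continuous t : continuous (lower t).
Proof.
apply: tvs_prod_continuous => n; rewrite /lower; case: (le t (rank n)) => /=.
  exact: (@cst_continuous _ L 0).
exact: tvs_prod_proj_continuous.
Qed.

Lemma insert_slice s x : insert (rank s) (slice (rank s) x) s = x s.
Proof. by rewrite /insert eqxx /slice dcK eqxx. Qed.

Lemma insert_off_slice t u s : rank s != t -> insert t u s = 0.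
Proof. by rewrite /insert => /negbTE ->. Qed.

Lemma slice_ext t x y : (forall s, rank s = t -> x s = y s) ->
  slice t x = slice t y.
Proof.
by move=> xy; apply/funext => n; rewrite /slice; case: eqP => // /xy.
Qed.

(** The diagonal block of [r] at [t]. Diagonal blocks of a block triangular
idempotent are idempotent ([slice_retraction_idem]), and their ranges are the
factors of the decomposition. *)
Definition slice_retraction t (u : Q) : Q := slice t (r (insert t u)).

Lemma slice_retraction_linear t : linear (slice_retraction t).
Proof. by move=> a x y; rewrite /slice_retraction /r !linearP. Qed.

(** If all blocks of [y] below [rank s] vanish, then by triangularity only the
block of [s] contributes to coordinate [s] of [r y]. *)
Lemma r_insert_slice s y : (forall s', ~~ le (rank s) (rank s') -> y s' = 0) ->
  r (insert (rank s) (slice (rank s) y)) s = r y s.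
Proof.
move=> y0; apply: r_ext => s' /le_ltP[<-|s's]; first by rewrite insert_slice.
rewrite y0// insert_off_slice//; apply: contraNneq s's => ->; exact: le_refl.
Qed.

Lemma slice_retraction_idem t u :
  slice_retraction t (slice_retraction t u) = slice_retraction t u.
Proof.
apply: slice_ext => s st; rewrite /slice_retraction -st r_insert_slice ?rr// => s' ss'.
apply: r_local => s'' s''s'; rewrite insert_off_slice//.
apply: contraNneq ss' => <-; exact: s''s'.
Qed.

Definition fixed_slice t : {pred Q} := [pred u | slice_retraction t u == u].

Lemma fixed_sliceP t u : reflect (slice_retraction t u = u) (u \in fixed_slice t).
Proof. exact: eqP. Qed.

Lemma fixed_slice_submod_closed t : submod_closed (fixed_slice t).
Proof.
have lin := slice_retraction_linear t; split.
  by apply/fixed_sliceP; rewrite /slice_retraction /r !linear0.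
move=> a u v /fixed_sliceP fu /fixed_sliceP fv; apply/fixed_sliceP.
by rewrite lin fu fv.
Qed.

HB.instance Definition _ t := GRing.isSubmodClosed.Build K Q (fixed_slice t)
  (fixed_slice_submod_closed t).
Local Notation F t := (subtvs (fixed_slice t)).
Local Notation Z := (tvs_prod (fun t => F t)).

Lemma slice_retractionE t (u : F t) : slice_retraction t (\val u) = \val u.
Proof. by case: u => u /= /fixed_sliceP. Qed.

Lemma fixed_slice_complemented t : exists p : {linear Q -> F t},
  continuous p /\ forall u : F t, p (\val u) = u.
Proof.
have in_slice u : slice_retraction t u \in subtvs_pred (fixed_slice t).
  by apply/fixed_sliceP; exact: slice_retraction_idem.
have [|p pE] := @linear_function _ Q (F t) (fun u => SubTvs (in_slice u)).
  by move=> a u v; apply/val_inj; exact: slice_retraction_linear.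
exists p; split.
  rewrite (funext pE); apply: subtvs_continuous => u.
  apply: (@continuous_comp _ _ _ (r \o insert t) (slice t)).
    by apply: continuous_comp; [exact: insert_continuous|exact: r_cont].
  exact: slice_continuous.
by move=> u; apply/val_inj; rewrite pE /= slice_retractionE.
Qed.

(** The compressions of [r] to the blocks below [t] and to the blocks up to [t]
are idempotent. Restriction maps the range of the second onto that of the first,
and [r] provides a section, which lifts the lower blocks of [x] to the blocks
up to [t] of [r (lower t x)]. The component of [x] is its difference with this
lift; it lies in the kernel of the restriction, which is the range of the
diagonal block. *)
Definition component (x : P) t : Q := slice t (x - r (lower t x)).

Lemma r_lower s t x : ~~ le t (rank s) -> r (lower t x) s = r x s.
Proof.
move=> st; apply: r_ext => s' s's; rewrite /lower ifN//.
by apply: contra st => /le_trans; apply.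
Qed.

Lemma r_insert s u : slice_retraction (rank s) u = u ->
  r (insert (rank s) u) s = insert (rank s) u s.
Proof. by move=> fu; rewrite -[in RHS]fu insert_slice. Qed.

Lemma component_fixed x t : r x = x -> component x t \in subtvs_pred (fixed_slice t).
Proof.
move=> rx; apply/fixed_sliceP/slice_ext => s st; rewrite -st r_insert_slice.
  by rewrite rB rr rx.
move=> s' s's; rewrite -[LHS]/(x s' - r (lower (rank s) x) s').
by rewrite r_lower// rx subrr.
Qed.

(** Inverting [component] amounts to solving this equation for [x]. Its right
side at [s] reads [x] only at indices of smaller rank, so it has a unique
solution by recursion on the rank; uniqueness makes the solution linear in [z],
and induction on the rank makes it continuous. *)
Definition assembles (z : Z) (x : P) :=
  forall s, x s = insert (rank s) (\val (z (rank s))) s + r (lower (rank s) x) s.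

Lemma assembles_exists z : exists x, assembles z x.
Proof.
apply: (wf_fixpoint (0 : L) rank_wf) => s x y xy.
congr (_ + _); congr (r _ s); apply/funext => s'; rewrite /lower.
by case: ifPn => // /xy.
Qed.

Lemma assembles_unique z x y : assembles z x -> assembles z y -> x = y.
Proof.
move=> zx zy; apply/funext => s.
elim/(well_founded_ind rank_wf): s => s IH.
rewrite zx zy; congr (_ + _); congr (r _ s); apply/funext => s'; rewrite /lower.
by case: ifPn => // /IH.
Qed.

Lemma assembles_linear a z z' x x' : assembles z x -> assembles z' x' ->
  assembles (a *: z + z') (a *: x + x').
Proof.
move=> zx zx' s; rewrite -[LHS]/(a *: x s + x' s) zx zx' /r !linearP.
rewrite -[X in _ = _ + X]/(a *: r (lower (rank s) x) s + r (lower (rank s) x') s).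
by rewrite scalerDr addrACA; congr (_ + _).
Qed.

(** By induction [x] agrees, up to rank [rank s], with a sum of two vectors on
which [r] acts as the identity in coordinate [s]: the inserted fixed vector of
the diagonal block, and a value of the idempotent [r]. *)
Lemma assembles_fixed z x : assembles z x -> r x = x.
Proof.
move=> zx; apply/funext => s.
elim/(well_founded_ind rank_wf): s => s IH.
set t := rank s; pose w := insert t (\val (z t)) + r (lower t x).
have -> : r x s = r w s.
  apply: r_ext => s'; rewrite -/t => /le_ltP[s't|s't].
    by rewrite zx s't.
  rewrite -[RHS]/(insert t (\val (z t)) s' + r (lower t x) s').
  rewrite insert_off_slice ?add0r ?r_lower// ?IH//.
  by apply: contraNneq s't => ->; exact: le_refl.
rewrite rD rr -[LHS]/(r (insert t (\val (z t))) s + r (lower t x) s).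
by rewrite r_insert ?slice_retractionE// -zx.
Qed.

Lemma component_assembles z x t : assembles z x -> component x t = \val (z t).
Proof.
move=> zx; rewrite -[RHS]slice_retractionE; apply: slice_ext => s st.
rewrite -st r_insert ?slice_retractionE//.
by rewrite -[LHS]/(x s - r (lower (rank s) x) s) {1}zx addrK.
Qed.

Lemma assembles_component x (z : Z) : r x = x ->
  (forall t, \val (z t) = component x t) -> assembles z x.
Proof.
move=> rx zx s; rewrite zx insert_slice.
by rewrite -[X in X + _]/(x s - r (lower (rank s) x) s) subrK.
Qed.

Lemma assembles_continuous (g : Z -> P) :
  (forall z, assembles z (g z)) -> continuous g.
Proof.
move=> gP; apply: tvs_prod_continuous => s.
elim/(well_founded_ind rank_wf): s => s IH.
rewrite (funext (fun z => gP z s)); apply: tvs_continuousD.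
  rewrite /insert eqxx => z.
  apply: (@continuous_comp Z Q L (fun z => \val (z (rank s)) : Q)
    (fun u : Q => u (c s))); last exact: tvs_prod_proj_continuous.
  apply: (@continuous_comp Z (F (rank s)) Q (fun z => z (rank s)) \val).
    exact: tvs_prod_proj_continuous.
  exact: subtvs_val_continuous.
move=> z; apply: (@continuous_comp Z P L (fun z => r (lower (rank s) (g z)))
    (fun x : P => x s)).
  apply: (@continuous_comp Z P P (fun z => lower (rank s) (g z)) r); last exact: r_cont.
  move: z; apply: tvs_prod_continuous => s'; rewrite /lower.
  case: (boolP (le (rank s) (rank s'))) => /= [_|/IH//].
  exact: (@cst_continuous _ L 0).
exact: tvs_prod_proj_continuous.
Qed.

Lemma slice_isomorphism : exists (f : {linear X -> Z}) (g : {linear Z -> X}),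
  [/\ cancel f g, cancel g f, continuous f & continuous g].
Proof.
have re x : r (e x) = e x by rewrite /r eK.
have [|f fE] := @linear_function _ X Z
    (fun x t => SubTvs (component_fixed t (re x))).
  move=> a x y; apply: functional_extensionality_dep => t; apply/val_inj => /=.
  rewrite -[RHS]/(a *: component (e x) t + component (e y) t).
  rewrite /component -linearP; congr (slice t _).
  by rewrite scalerBr addrACA -opprD /r !linearP.
have [g gP] := choice assembles_exists.
have gL : linear g.
  move=> a z z'; apply: assembles_unique (gP _) _; exact: assembles_linear.
have [h hE] := linear_function gL.
exists f, (q \o h); split.
- move=> x; rewrite /= hE -[RHS]eK; congr (q _).
  apply: assembles_unique (gP _) (assembles_component (re x) _) => t.
  by rewrite fE.
- move=> z; rewrite fE; apply: functional_extensionality_dep => t.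
  apply/val_inj => /=; rewrite hE -[e _]/(r (g z)).
  by rewrite (assembles_fixed (gP z)); exact: component_assembles.
- rewrite (funext fE); apply: tvs_prod_continuous => t; apply: subtvs_continuous.
  have [k kE] : exists k : {linear P -> Q}, k =1 component^~ t.
    apply: linear_function => a x y; rewrite /component -linearP.
    by congr (slice t _); rewrite scalerBr addrACA -opprD /r !linearP.
  move=> x; apply: (@continuous_comp _ _ _ e (component^~ t)); first exact: e_cont.
  apply: (@continuous_comp _ _ _ (fun x => x - r (lower t x)) (slice t));
    last exact: slice_continuous.
  apply: tvs_continuousD; first by move=> y; exact: cvg_id.
  move=> y; apply: (@continuous_comp _ _ _ (r \o lower t) -%R);
    last exact: opp_continuous.
  by apply: continuous_comp; [exact: lower_continuous|exact: r_cont].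
- move=> z; apply: continuous_comp; last exact: q_cont.
  by rewrite (funext hE); exact: assembles_continuous.
Qed.

Lemma slice_decomposition : exists F : S -> submodClosed Q,
  (forall t, exists p : {linear Q -> subtvs (F t)},
     continuous p /\ forall u : subtvs (F t), p (\val u) = u) /\
  exists (f : {linear X -> tvs_prod (fun t => subtvs (F t))})
         (g : {linear tvs_prod (fun t => subtvs (F t)) -> X}),
    [/\ cancel f g, cancel g f, continuous f & continuous g].
Proof.
exists (fun t => fixed_slice t : submodClosed Q).
by split; [exact: fixed_slice_complemented|exact: slice_isomorphism].
Qed.

End decomposition.

(** * The characterization of injective spaces *)

(** A basic neighbourhood of zero in a product constrains finitely many
coordinates, so it contains the vectors that vanish there. *)
Lemma nbhs0_tvs_prod (K : numFieldType) (I : choiceType) (T : I -> tvsType K)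
    (U : set (tvs_prod T)) : nbhs (0 : tvs_prod T) U ->
  exists l : seq I, forall x : tvs_prod T, (forall i, i \in l -> x i = 0) -> U x.
Proof.
pose G : set_system (tvs_prod T) := [set V | exists l : seq I,
  forall x : tvs_prod T, (forall i, i \in l -> x i = 0) -> V x].
have GF : Filter G.
  split; first by exists [::].
    move=> V W [l lV] [m mW]; exists (l ++ m) => x x0; split.
      by apply: lV => i il; apply: x0; rewrite mem_cat il.
    by apply: mW => i im; apply: x0; rewrite mem_cat im orbT.
  by move=> V W VW [l lV]; exists l => x /lV; exact: VW.
suff : G --> (0 : tvs_prod T) by move=> /[apply].
apply/cvg_sup => i V [_ [[W oW <-] W0] WV]; exists [:: i] => x x0.
by apply: WV; rewrite /= x0 ?mem_head.
Qed.

(** The vectors vanishing on suitable finitely many coordinates form a subspace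
that [f] maps into the unit ball; the only linear subspace of a normed space
inside its unit ball is zero. *)
Lemma finite_dependency (K : numFieldType) (I : choiceType) (T : I -> tvsType K)
    (N : normedModType K) (f : {linear tvs_prod T -> N}) : continuous f ->
  exists l : seq I, forall x : tvs_prod T, (forall i, i \in l -> x i = 0) -> f x = 0.
Proof.
move=> cf; have U0 : nbhs (0 : N) [set y | `|y| < 1].
  by apply: (nbhs_norm0P (V := N)).2; exists 1 => //=.
have [l lU] := nbhs0_tvs_prod (nbhs0_pullback cf U0).
exists l => x x0; apply/eqP; apply: contraT => fx0.
have /lU : forall i, i \in l -> (`|f x|^-1 *: x) i = 0.
  by move=> i il; rewrite -[LHS]/(_ *: x i) x0// scaler0.
by rewrite /= linearZ normrZ normfV normr_id mulVf ?normr_eq0// ltxx.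
Qed.

Theorem theorem5p2 (R : realType) (X : tvsType R[i]) (hX : hausdorff_space X) :
  lcs_injective X <->
  exists (T : Type) (J : T -> nat -> Type)
    (F : forall t : T,
       submodClosed (tvs_prod (fun n : nat => ell_infty R (J t n)))),
    (forall t : T, complemented (F t)) /\
    lcs_isomorphic X (tvs_prod (fun t : T => subtvs (F t))).
Proof.
split=> [injX|[T [J [F [cF [f [g [fK _ cf cg]]]]]]]]; last first.
  apply: (retract_injective cf cg fK); apply: tvs_prod_injective => t.
  have [p [cp pK]] := cF t.
  apply: (retract_injective (@subtvs_val_continuous _ _ (F t)) cp pK).
  by apply: tvs_prod_injective => n; exact: ell_infty_injective.
have [e [q [ce cq eK]]] := injective_retract_of_power hX injX.
pose S : choiceType := {classic (X -> R)}.
pose L := ell_infty R (X -> R[i]^o).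
have dep (s : S) : exists l : seq S, forall x : tvs_prod (fun _ : S => L),
    (forall i, i \in l -> x i = 0) -> e (q x) s = 0.
  have [|h hE] := @linear_function _ (tvs_prod (fun _ : S => L)) L
      (fun x => e (q x) s).
    by move=> a x y; rewrite !linearP.
  have [|l lP] := @finite_dependency _ S (fun=> L) L h.
    rewrite (funext hE) => x.
    apply: (@continuous_comp _ _ _ (e \o q) (fun y : tvs_prod (fun _ : S => L) => y s)).
      by apply: continuous_comp; [exact: cq|exact: ce].
    exact: tvs_prod_proj_continuous.
  by exists l => x /lP; rewrite hE.
have [D DP] := choice dep.
have [le [rank [d [le_order le_wf Dle dP]]]] := ranking_exists D.
have [c cP] := choice dP.
have [|F [cF iso]] := slice_decomposition ce cq eK le_order le_wf cP.
  by move=> s x x0; apply: DP => s' /Dle; exact: x0.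
by exists S, (fun _ _ => X -> R[i]^o), F.
Qed.
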